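(* Let $G$ be a Heisenberg-Reiter group with Lie algebra $\mathfrak{g}=\mathfrak{u}_1\dot{+}\mathfrak{u}_2\dot{+}\mathfrak{w}=\mathfrak{v}\dot{+}\mathfrak{z}$, $\mathfrak{v}=\mathfrak{v}_1\dot{+}\mathfrak{v}_2$, and scalar product $\langle\cdot,\cdot\rangle$ as in the context. Let $Y=Y_{\mathfrak{v}}+Y_{\mathfrak{z}}\in\mathfrak{g}$ with $Y_{\mathfrak{v}}\in\ker(j(Y_{\mathfrak{z}}))$, and write $Y_{\mathfrak{z}}=\overline{Y_{\mathfrak{z}}}+(Y_{\mathfrak{z}})_0$ with $\overline{Y_{\mathfrak{z}}}\in\mathfrak{u}_1^{\circ}\dot{+}\mathfrak{u}_2^{\circ}$ and $(Y_{\mathfrak{z}})_0\in\mathfrak{w}$. Assume that the operator $j_B^{21}((Y_{\mathfrak{z}})_0)\,j_B^{12}((Y_{\mathfrak{z}})_0):\mathfrak{v}_2\to\mathfrak{v}_2$ is diagonalizable over $\mathbb{R}$ and that the image of $j_B^{12}((Y_{\mathfrak{z}})_0):\mathfrak{v}_2\to\mathfrak{v}_1$ is a non-degenerate subspace of $(\mathfrak{v}_1,\langle\cdot,\cdot\rangle_{\mathfrak{v}_1})$. Then the equilibrium point $Y$ of the Lie-Poisson equation $\frac{dY_{\mathfrak{v}}}{dt}=j(Y_{\mathfrak{z}})Y_{\mathfrak{v}}$, $\frac{dY_{\mathfrak{z}}}{dt}=0$, restricted to the coadjoint orbit through $Y$, has Williamson type $(d_1+d_4,\;d_2+d_3,\;0)$,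 where $d_1,d_2,d_3,d_4$ are the numbers defined in the context.
   Context: Heisenberg-Reiter groups. $G$ is a Lie group whose (real, finite-dimensional) Lie algebra is a vector space direct sum $\mathfrak{g}=\mathfrak{u}_1\dot{+}\mathfrak{u}_2\dot{+}\mathfrak{w}$ with bracket $$[(U_1,U_2,W),(U_1',U_2',W')]=(0,0,B(U_1,U_2')-B(U_1',U_2)),$$ for a given bilinear map $B:\mathfrak{u}_1\times\mathfrak{u}_2\to\mathfrak{w}$. Put $\mathfrak{u}_1^{\circ}=\{U_1\in\mathfrak{u}_1: B(U_1,U_2)=0\ \forall U_2\in\mathfrak{u}_2\}$, $\mathfrak{u}_2^{\circ}=\{U_2\in\mathfrak{u}_2: B(U_1,U_2)=0\ \forall U_1\in\mathfrak{u}_1\}$. The centre is $\mathfrak{z}=\mathfrak{u}_1^{\circ}\dot{+}\mathfrak{u}_2^{\circ}\dot{+}\mathfrak{w}$. $\langle\cdot,\cdot\rangle$ is a scalar product (non-degenerate symmetric bilinear form, possibly indefinite) on $\mathfrak{g}$ such that $\mathfrak{u}_1,\mathfrak{u}_2,\mathfrak{w}$ are pairwise orthogonal and its restrictions to $\mathfrak{u}_1$, $\mathfrak{u}_2$, $\mathfrak{w}$ are non-degenerate. Let $\mathfrak{v}=\mathfrak{z}^{\perp}\subset\mathfrak{u}_1\dot{+}\mathfrak{u}_2$ and $\mathfrak{v}_i=\mathfrak{v}\cap\mathfrak{u}_i$; it is assumed that the restrictions $\langle\cdot,\cdot\rangle_{\mathfrak{v}_i}$ to $\mathfrak{v}_i$,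 $i=1,2$, are non-degenerate. Then $\mathfrak{g}=\mathfrak{v}\dot{+}\mathfrak{z}$ orthogonally, $\mathfrak{v}=\mathfrak{v}_1\dot{+}\mathfrak{v}_2$, $\mathfrak{u}_i=\mathfrak{v}_i\dot{+}\mathfrak{u}_i^{\circ}$, and the restriction $\langle\cdot,\cdot\rangle_{\mathfrak{z}}$ to $\mathfrak{z}$ is non-degenerate. The $j$-mapping $j:\mathfrak{z}\to\mathrm{End}(\mathfrak{v})$ is defined by $\langle j(Z)V,V'\rangle=\langle Z,[V,V']\rangle$ for $V,V'\in\mathfrak{v}$. For $W\in\mathfrak{w}$ define $j_B^{12}(W):\mathfrak{v}_2\to\mathfrak{v}_1$ and $j_B^{21}(W):\mathfrak{v}_1\to\mathfrak{v}_2$ by $\langle j_B^{12}(W)V_2,V_1\rangle_{\mathfrak{v}_1}=\langle j_B^{21}(W)V_1,V_2\rangle_{\mathfrak{v}_2}=\langle W,B(V_1,V_2)\rangle_{\mathfrak{w}}$ for $V_i\in\mathfrak{v}_i$. The numbers $d_i$. Let $\Phi=j_B^{12}((Y_{\mathfrak{z}})_0)$ and $\Phi^*=j_B^{21}((Y_{\mathfrak{z}})_0)$ (mutually adjoint). Under the diagonalizability hypothesis there is a basis $B_1,\dots,B_{m_2}$ of $\mathfrak{v}_2$ consisting of eigenvectors of $\Phi^*\circ\Phi$, with real eigenvalues $\lambda_1,\dots,\lambda_{m_2}$, that are pairwise orthogonal with $\langle B_i,B_i\rangle_{\mathfrak{v}_2}=\pm1$. Then $d_1$ (resp. $d_2$)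 is the number of $i$ with $\langle B_i,B_i\rangle_{\mathfrak{v}_2}=1$ and $\lambda_i>0$ (resp. $\lambda_i<0$), and $d_3$ (resp. $d_4$) is the number of $i$ with $\langle B_i,B_i\rangle_{\mathfrak{v}_2}=-1$ and $\lambda_i<0$ (resp. $\lambda_i>0$). Coadjoint orbits. Identify $\mathfrak{g}\cong\mathfrak{g}^*$ via $Y\mapsto\langle Y,\cdot\rangle$. With $A^{\mathrm{T}}$ the adjoint of $A$ for $\langle\cdot,\cdot\rangle$, the coadjoint orbit through $Y$ is $\{(\mathrm{Ad}_q)^{\mathrm{T}}Y:q\in G\}$, with tangent space $\{(\mathrm{ad}_U)^{\mathrm{T}}Y:U\in\mathfrak{g}\}=\mathrm{Im}\,j(Y_{\mathfrak{z}})$ at $Y$ and orbit symplectic form $\omega_Y((\mathrm{ad}_U)^{\mathrm{T}}Y,(\mathrm{ad}_{U'})^{\mathrm{T}}Y)=-\langle Y,[U,U']\rangle$. The Lie-Poisson equation of the claim (Hamiltonian $h(Y)=\tfrac12\langle Y,Y\rangle$) restricts to a Hamiltonian system on each orbit. Williamson type. Let $x$ be an equilibrium of a Hamiltonian system on a $2N$-dimensional symplectic manifold, and suppose all eigenvalues of the linearization of the Hamiltonian vector field at $x$ are non-zero. Counted with multiplicity, they consist of $2k_e$ purely imaginary numbers (pairs $\pm\mu_i\sqrt{-1}$), $2k_h$ real numbers (pairs $\pm\mu_r$) and $4k_f$ complex numbers (quadruples $\pm\mu_r\pm\mu_i\sqrt{-1}$), $\mu_r,\mu_i\in\mathbb{R}\setminus\{0\}$;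 so $k_e+k_h+2k_f=N$. The Williamson type of $x$ is $(k_e,k_h,k_f)$. *)

(* Defs.v *)
From HB Require Import structures.
From mathcomp Require Import all_boot all_order all_algebra.
From mathcomp Require Import sesquilinear.
From mathcomp Require Import all_classical all_reals all_analysis.
From mathcomp Require Import complex.

Set Implicit Arguments.
Unset Strict Implicit.
Unset Printing Implicit Defensive.

Import Order.TTheory GRing.Theory Num.Theory.
Import numFieldNormedType.Exports.

Local Open Scope ring_scope.

Section Forms.
Variables (F : fieldType) (V : vectType F).

Section Restriction.
Variables (f : {symmetric V}) (U : {vspace V}).

Definition restr (x y : subvs_of U) : F := f (vsval x) (vsval y).

Fact restr_bilinear : bilinear_for *%R (idfun \; *%R) restr.
Proof. by split=> u a x y; rewrite /restr /= (linearPl, linearPr). Qed.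

HB.instance Definition _ :=
  bilinear_isBilinear.Build F (subvs_of U) (subvs_of U) F
    *%R (idfun \; *%R) restr restr_bilinear.

Fact restr_sym (x y : subvs_of U) :
  restr x y = (-1) ^+ false * idfun (restr y x).
Proof. exact: hermC. Qed.

HB.instance Definition _ :=
  isHermitianSesquilinear.Build F (subvs_of U) false idfun restr restr_sym.

End Restriction.

(* The vector representing [phi]; it is unique when [f] is non-degenerate. *)
Definition riesz (f : V -> V -> F) (phi : V -> F) : V :=
  xget 0 [set x | forall y, f x y = phi y]%classic.

Definition transpose (f : V -> V -> F) (A : 'End(V)) : 'End(V) :=
  linfun (fun x => riesz f (fun y => f x (A y))).

Definition diagonalizable_lfun (A : 'End(V)) : Prop :=
  exists2 b : seq V, basis_of fullv b &
    forall x, x \in b -> exists a : F, A x = a *: x.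

End Forms.

Arguments restr {F V} f U x y.

(* Derivative of a curve in a finite-dimensional space, tested on linear forms:
   an abstract [vectType] carries no canonical norm. *)
Definition is_velocity (R : realType) (V : vectType R) (c : R -> V) (t : R)
    (v : V) : Prop :=
  forall phi : 'Hom(V, R^o), is_derive t 1 (fun s => phi (c s) : R) (phi v).

(* A group with an exponential map and an adjoint representation whose
   differential is ad: the part of the structure of a Lie group with Lie algebra
   [(L, br)] that acts on [L].  Every such Lie group, connected or not, yields
   an instance; the smooth structure itself is not recorded. *)
Record lie_group (R : realType) (L : vectType R) (br : L -> L -> L) := LieGroup {
  lg_sort :> groupType;
  lg_exp : L -> lg_sort;
  lg_Ad : lg_sort -> 'End(L);
  lg_expD : forall (s t : R) U,
    lg_exp ((s + t) *: U) = (lg_exp (s *: U) * lg_exp (t *: U))%g;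
  lg_Ad1 : lg_Ad 1%g = \1%VF;
  lg_AdM : forall p q, lg_Ad (p * q)%g = (lg_Ad p \o lg_Ad q)%VF;
  lg_Ad_br : forall q U X, lg_Ad q (br U X) = br (lg_Ad q U) (lg_Ad q X);
  lg_conj : forall q U, (q * lg_exp U * q^-1)%g = lg_exp (lg_Ad q U);
  lg_dAd : forall U X,
    is_velocity (fun t : R => lg_Ad (lg_exp (t *: U)) X) 0 (br U X)
}.

Section CoadjointOrbits.
Variables (R : realType) (L : vectType R) (br : L -> L -> L).
Variables (ip : L -> L -> R) (G : lie_group br).

Definition coAd (q : G) (Y : L) : L := transpose ip (lg_Ad q) Y.
Definition coad (U Y : L) : L := transpose ip (linfun (br U)) Y.

Definition coadjoint_orbit (Y : L) : set L := [set coAd q Y | q in setT]%classic.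

Definition orbit_tangent (Y : L) : {vspace L} := limg (linfun (coad^~ Y)).

(* [(linfun (coad^~ Y))^-1 xi] is some [U] with [coad U Y = xi]; the value of
   the form does not depend on this choice. *)
Definition orbit_form (Y xi eta : L) : R :=
  let U x := (linfun (coad^~ Y))^-1%VF x in - ip Y (br (U xi) (U eta)).

(* [X] restricts to the Hamiltonian vector field of [h] on the orbit of [Y]. *)
Definition hamiltonian_on_orbit (h : L -> R) (X : L -> L) (Y : L) : Prop :=
  forall P, coadjoint_orbit Y P ->
  [/\ X P \in orbit_tangent P,
      {in orbit_tangent P, forall xi,
        {in orbit_tangent P, forall eta, orbit_form P xi eta = 0} -> xi = 0} &
      {in orbit_tangent P, forall xi,
        is_derive (0 : R) 1 (fun t : R => h (P + t *: xi))
          (orbit_form P (X P) xi)}].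

(* The tangent vectors of the orbit at [Y] are the velocities of the curves
   [t |-> (Ad (exp (t U)))^T Y]; the linearization at an equilibrium sends such a
   velocity to the derivative of the vector field along the curve. *)
Definition is_orbit_linearization (X : L -> L) (Y : L)
    (A : 'End(subvs_of (orbit_tangent Y))) : Prop :=
  forall (U : L) (xi : subvs_of (orbit_tangent Y)), vsval xi = coad U Y ->
  let c (t : R) := coAd (lg_exp G (t *: U)) Y in
  is_velocity c 0 (vsval xi) /\ is_velocity (X \o c) 0 (vsval (A xi)).

End CoadjointOrbits.

Section Williamson.
Variable R : realType.

Definition char_poly_lfun (V : vectType R) (A : 'End(V)) : {poly R} :=
  char_poly (passmx.mxof (vbasis fullv) (vbasis fullv) A).

(* [s] lists the complex eigenvalues with algebraic multiplicity. *)
Definition williamson_spectrum (V : vectType R) (A : 'End(V))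
    (ke kh kf : nat) : Prop :=
  exists s : seq R[i],
  [/\ map_poly (real_complex R) (char_poly_lfun A)
        = \prod_(z <- s) ('X - z%:P),
      0 \notin s,
      count (fun z : R[i] => complex.Re z == 0) s = (2 * ke)%N,
      count (fun z : R[i] => complex.Im z == 0) s = (2 * kh)%N &
      count (fun z : R[i] => (complex.Re z != 0) && (complex.Im z != 0)) s
        = (4 * kf)%N].

Definition orbit_williamson_type (L : vectType R) (br : L -> L -> L)
    (ip : L -> L -> R) (G : lie_group br) (h : L -> R) (X : L -> L) (Y : L)
    (ke kh kf : nat) : Prop :=
  [/\ hamiltonian_on_orbit ip G h X Y, X Y = 0 &
      exists2 A : 'End(subvs_of (orbit_tangent br ip Y)),
        is_orbit_linearization G X A & williamson_spectrum A ke kh kf].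

End Williamson.

Section HeisenbergReiter.
Variables (R : realType) (u1 u2 w : vectType R) (B : {bilinear u1 -> u2 -> w}).

Local Notation g := (u1 * u2 * w)%type.

Definition hr_bracket (X Y : g) : g :=
  (0, 0, B X.1.1 Y.1.2 - B Y.1.1 X.1.2).

Definition in_u1 (x : u1) : g := (x, 0, 0).
Definition in_u2 (y : u2) : g := (0, y, 0).
Definition in_w (z : w) : g := (0, 0, z).

Definition hr_u1 : {vspace g} := limg (linfun in_u1).
Definition hr_u2 : {vspace g} := limg (linfun in_u2).
Definition hr_w : {vspace g} := limg (linfun in_w).

(* The left and right radicals of [B], as subspaces of [g]. *)
Definition hr_u1o : {vspace g} :=
  (linfun in_u1 @: lker (linfun (fun x : u1 => linfun (B x))))%VS.
Definition hr_u2o : {vspace g} :=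
  (linfun in_u2 @: lker (linfun (fun y : u2 => linfun (B^~ y))))%VS.

Definition hr_z : {vspace g} := (hr_u1o + hr_u2o + hr_w)%VS.

Variable ip : {symmetric g}.

Definition hr_v : {vspace g} := orthov ip hr_z.
Definition hr_v1 : {vspace g} := (hr_v :&: hr_u1)%VS.
Definition hr_v2 : {vspace g} := (hr_v :&: hr_u2)%VS.

Record hr_scalar_product : Prop := {
  hr_ip_nondeg : nondegenerate ip;
  hr_ip_u12 : (hr_u1 <= orthov ip hr_u2)%VS;
  hr_ip_u1w : (hr_u1 <= orthov ip hr_w)%VS;
  hr_ip_u2w : (hr_u2 <= orthov ip hr_w)%VS;
  hr_ip_u1 : nondegenerate (restr ip hr_u1);
  hr_ip_u2 : nondegenerate (restr ip hr_u2);
  hr_ip_w : nondegenerate (restr ip hr_w);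
  hr_ip_v1 : nondegenerate (restr ip hr_v1);
  hr_ip_v2 : nondegenerate (restr ip hr_v2)
}.

Definition hr_j (Z : g) : 'End(subvs_of hr_v) :=
  linfun (fun x => riesz (restr ip hr_v)
    (fun y => ip Z (hr_bracket (vsval x) (vsval y)))).

Definition hr_j12 (W : w) : 'Hom(subvs_of hr_v2, subvs_of hr_v1) :=
  linfun (fun y => riesz (restr ip hr_v1)
    (fun x => ip (in_w W) (in_w (B (vsval x).1.1 (vsval y).1.2)))).

Definition hr_j21 (W : w) : 'Hom(subvs_of hr_v1, subvs_of hr_v2) :=
  linfun (fun x => riesz (restr ip hr_v2)
    (fun y => ip (in_w W) (in_w (B (vsval x).1.1 (vsval y).1.2)))).

Definition lie_poisson (P : g) : g :=
  vsval (hr_j (daddv_pi hr_z hr_v P) (vsproj hr_v (daddv_pi hr_v hr_z P))).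

Definition hr_hamiltonian (P : g) : R := 2^-1 * ip P P.

Record adapted_eigenbasis (W : w) (b : (\dim hr_v2).-tuple (subvs_of hr_v2))
    (lam : 'I_(\dim hr_v2) -> R) : Prop := {
  aeb_basis : basis_of fullv b;
  aeb_eigen : forall i,
    (hr_j21 W \o hr_j12 W)%VF (tnth b i) = lam i *: tnth b i;
  aeb_ortho : forall i j, i != j -> restr ip _ (tnth b i) (tnth b j) = 0;
  aeb_norm : forall i, restr ip _ (tnth b i) (tnth b i) = 1 \/
                       restr ip _ (tnth b i) (tnth b i) = -1
}.

Section Counts.
Variables (b : (\dim hr_v2).-tuple (subvs_of hr_v2)).
Variables (lam : 'I_(\dim hr_v2) -> R).

Let nrm i := restr ip _ (tnth b i) (tnth b i).

Definition hr_d1 : nat := #|[set i | (nrm i == 1) && (0 < lam i)]|.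
Definition hr_d2 : nat := #|[set i | (nrm i == 1) && (lam i < 0)]|.
Definition hr_d3 : nat := #|[set i | (nrm i == -1) && (lam i < 0)]|.
Definition hr_d4 : nat := #|[set i | (nrm i == -1) && (0 < lam i)]|.

End Counts.

End HeisenbergReiter.

(* Main.v *)
Require Import Defs.
From HB Require Import structures.
From mathcomp Require Import all_boot all_order all_algebra.
From mathcomp Require Import sesquilinear.
From mathcomp Require Import all_classical all_reals all_analysis.
From mathcomp Require Import complex ring.

Set Implicit Arguments.
Unset Strict Implicit.
Unset Printing Implicit Defensive.

Import Order.TTheory GRing.Theory Num.Theory.

Local Open Scope ring_scope.

(** The Lie-Poisson field sends [P] to [coad P P], where [coad U P] represents
[V |-> <P, [U, V]>]. For such a field everything about the orbit is formal: it is
the Hamiltonian field of half the square norm ([euler_hamiltonian]), and its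
linearization at [Y] sends a tangent vector [xi] to [coad xi Y + coad Y xi]
([euler_linearization]). In a Heisenberg-Reiter algebra brackets are central and
tangent vectors are orthogonal to the centre, so that [coad Y xi = 0]
([coad_tangent]) and the linearization is [xi |-> coad xi Y].

Write [Phi] for [j12 ((Yz)_0)] and [Psi] for its adjoint [j21 ((Yz)_0)]. On [v1]
the map [coad _ Y] is [Psi], on [v2] it is [- Phi], and on the centre it is zero
([coad_v1], [coad_v2], [coad_z]). Hence the tangent space of the orbit is the sum
of the images of [Psi] and [Phi]. Let [b] be an orthonormal eigenbasis of
[Psi o Phi] with eigenvalues [lam]. It exists because orthogonalization can be
done inside the eigenspaces, also for indefinite forms
([orthonormal_eigenbasis]). Nondegeneracy of the image of [Phi] forces
[Phi (b i) = 0] when [lam i = 0] ([lam0_Phi]), and then the vectors [b i] and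
[- Phi (b i)] with [lam i != 0] form a basis of the tangent space ([pq_free],
[pq_span]).

The linearization sends [b i] to [- Phi (b i)] and [- Phi (b i)] to
[- lam i *: b i], so its characteristic polynomial is the product of the
[X^2 + lam i] over the nonzero eigenvalues ([char_poly_paired]). A positive
[lam i] gives a purely imaginary pair of eigenvalues and a negative one a real
pair ([williamson_paired]); sorting the indices further by the sign of
[<b i, b i>] gives the numbers [d1 + d4] and [d2 + d3]. *)

(** * Nondegenerate symmetric forms *)

Lemma linfunE (F : fieldType) (U V : vectType F) (h : U -> V) :
  linear h -> linfun h =1 h.
Proof.
move=> lh x.
pose T : {linear U -> V} := HB.pack h (GRing.isLinear.Build _ _ _ _ h lh).
exact: (lfunE T).
Qed.

Section NondegenerateForms.
Variables (F : fieldType) (V : vectType F) (f : {symmetric V}).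

Lemma symC x y : f x y = f y x.
Proof. by rewrite hermC mul1r. Qed.

(** The general bilinearity lemmas return terms headed by the coercion of [f] to
bilinear maps, to which equations about [f] itself no longer apply by rewriting;
the variants below keep [f] as the head. *)
Lemma sym0l y : f 0 y = 0. Proof. exact: linear0l. Qed.
Lemma symDl x y z : f (x + y) z = f x z + f y z. Proof. exact: linearDl. Qed.
Lemma symBl x y z : f (x - y) z = f x z - f y z. Proof. exact: linearBl. Qed.
Lemma symNl x y : f (- x) y = - f x y. Proof. exact: linearNl. Qed.
Lemma symZl a x y : f (a *: x) y = a * f x y. Proof. exact: linearZl_LR. Qed.
Lemma sym_suml I (r : seq I) (P : pred I) (E : I -> V) y :
  f (\sum_(i <- r | P i) E i) y = \sum_(i <- r | P i) f (E i) y.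
Proof. exact: linear_sumlz. Qed.

Lemma sym0r y : f y 0 = 0. Proof. by rewrite symC sym0l. Qed.
Lemma symDr x y z : f z (x + y) = f z x + f z y.
Proof. by rewrite symC symDl !(symC z). Qed.
Lemma symBr x y z : f z (x - y) = f z x - f z y.
Proof. by rewrite symC symBl !(symC z). Qed.
Lemma symNr x y : f y (- x) = - f y x. Proof. by rewrite symC symNl symC. Qed.
Lemma symZr a x y : f y (a *: x) = a * f y x.
Proof. by rewrite symC symZl symC. Qed.
Lemma sym_sumr I (r : seq I) (P : pred I) (E : I -> V) y :
  f y (\sum_(i <- r | P i) E i) = \sum_(i <- r | P i) f y (E i).
Proof. by rewrite symC sym_suml; apply: eq_bigr => i _; exact: symC. Qed.

Lemma symPr a x y z : f z (a *: x + y) = a * f z x + f z y.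
Proof. by rewrite symDr symZr. Qed.

Lemma nondegP : nondegenerate f <-> (forall x, (forall y, f x y = 0) -> x = 0).
Proof.
split=> [/eqP rad0 x x0|H].
  apply/eqP; rewrite -memv0 -rad0; apply/mem_orthovP => y _; exact: x0.
apply/eqP/vspaceP => x; rewrite memv0; apply/mem_orthovP/eqP => [x0|-> y _].
  by apply: H => y; apply: x0; rewrite memvf.
by rewrite sym0l.
Qed.

Hypothesis f_nondeg : nondegenerate f.

Lemma nondeg_eq x y : (forall z, f x z = f y z) -> x = y.
Proof.
move=> xy; apply/eqP; rewrite -subr_eq0; apply/eqP; apply: (nondegP.1 f_nondeg) => z.
by rewrite symBl xy subrr.
Qed.

(** The map sending [x] to the row of its pairings with a basis is injective by
nondegeneracy, hence onto for dimension reasons; a preimage of the values of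
[phi] on the basis represents [phi]. *)
Lemma riesz_exists (phi : V -> F^o) : linear phi ->
  exists x, forall y, f x y = phi y.
Proof.
move=> lphi.
pose e := vbasis {:V}.
pose T x := \row_i f x (tnth e i).
have lT : linear T.
  by move=> a x y; apply/rowP => i; rewrite !mxE symDl symZl.
pose Tl := GRing.isLinear.Build _ _ _ _ T lT.
pose TL : {linear V -> 'rV_(\dim {:V})} := HB.pack T Tl.
have ext (psi : V -> F^o) x : linear psi ->
    (forall i, f x (tnth e i) = psi (tnth e i)) -> forall y, f x y = psi y.
  move=> lpsi H y; pose psiL : {linear V -> F^o} :=
    HB.pack psi (GRing.isLinear.Build _ _ _ _ psi lpsi).
  rewrite (coord_vbasis (memvf y)) sym_sumr.
  rewrite -[RHS]/(psiL _) linear_sum; apply: eq_bigr => i _.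
  by rewrite symZr linearZ_LR /= -(tnth_nth 0) H.
have kT : lker (linfun TL) == 0%VS.
  apply/lker0P => x y; rewrite !lfunE /= => Txy; apply: nondeg_eq => z.
  apply: (ext (f y)) => [|i]; first by move=> a u v; rewrite symDr symZr.
  by have /rowP/(_ i) := Txy; rewrite !mxE.
have iT : limg (linfun TL) = fullv.
  apply/eqP; rewrite -(dimv_leqif_eq (subvf _)) limg_dim_eq ?(eqP kT) ?capv0 //.
  by rewrite !dimvf /dim /= mul1n.
have /memv_imgP [x _ Hx] :
    (\row_i phi (tnth e i) : 'rV_(\dim {:V})) \in limg (linfun TL).
  by rewrite iT; exact: memvf.
exists x; apply: ext => // i.
by move/rowP: Hx => /(_ i); rewrite lfunE !mxE.
Qed.

Lemma rieszE (phi : V -> F^o) : linear phi -> forall y, f (riesz f phi) y = phi y.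
Proof.
by move=> /riesz_exists[x Hx]; rewrite /riesz; case: xgetP => [z _ //|/(_ x)].
Qed.

Lemma riesz_linear (U : vectType F) (phi : U -> V -> F^o) :
  (forall x, linear (phi x)) -> (forall y, linear (phi^~ y)) ->
  linear (fun x => riesz f (phi x)).
Proof.
move=> l1 l2 a x y; apply: nondeg_eq => z.
by rewrite symDl symZl !rieszE // l2.
Qed.

Lemma linfun_rieszE (U : vectType F) (phi : U -> V -> F^o) :
  (forall x, linear (phi x)) -> (forall y, linear (phi^~ y)) ->
  forall x y, f (linfun (fun x => riesz f (phi x)) x) y = phi x y.
Proof.
move=> l1 l2 x y.
by rewrite linfunE ?rieszE //; exact: riesz_linear.
Qed.

Lemma transposeE (A : 'End(V)) x y : f (transpose f A x) y = f x (A y).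
Proof.
rewrite /transpose linfun_rieszE // => [z|z] a u v; last first.
  by rewrite symDl symZl.
by rewrite linearP symDr symZr.
Qed.

End NondegenerateForms.

(** * Orthonormal eigenbases for indefinite forms *)

Section OrthogonalFamilies.
Variables (F : fieldType) (V : vectType F) (f : {symmetric V}).
Implicit Type s : seq V.

Definition orthogonal_seq s :=
  [/\ uniq s, {in s &, forall x y, x != y -> f x y = 0}
     & {in s, forall x, f x x != 0}].

(** The component of [x] orthogonal to [s]: one step of Gram-Schmidt, available in
any signature as soon as no member of [s] is isotropic. *)
Definition ortho_rest s x := x - \sum_(z <- s) (f x z / f z z) *: z.

Lemma ortho_restP s : orthogonal_seq s -> {in s, forall z x, f (ortho_rest s x) z = 0}.
Proof.
move=> [us os ns] z zs x; rewrite /ortho_rest symBl sym_suml (bigD1_seq z) //=.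
rewrite symZl divfK ?ns // big1_seq ?addr0 ?subrr // => y /andP[yz ys].
by rewrite symZl os ?mulr0.
Qed.

Lemma ortho_rest_span s x : ortho_rest s x = 0 -> x \in << s >>%VS.
Proof.
move/eqP; rewrite subr_eq0 => /eqP ->.
by rewrite big_seq memv_suml // => z zs; rewrite memvZ ?memv_span.
Qed.

Lemma orthogonal_seq_free s : orthogonal_seq s -> free s.
Proof.
elim: s => [_|x s IH]; first exact: nil_free.
move=> [/= /andP[xs us] os ns].
have os' : {in s &, forall x y, x != y -> f x y = 0}.
  by move=> y z ys zs; apply: os; rewrite inE (ys, zs) orbT.
have ns' : {in s, forall x, f x x != 0}.
  by move=> y ys; apply: ns; rewrite inE ys orbT.
rewrite free_cons IH // andbT; apply/negP => xspan.
have /negP[] := ns x (mem_head _ _).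
suff /subvP/(_ x xspan)/mem_orthovP/(_ x (memv_line x)) -> :
  (<< s >> <= orthov f <[x]>)%VS by [].
apply/span_subvP => y ys; rewrite mem_orthov1; apply/eqP/os;
  rewrite ?inE ?eqxx ?ys ?orbT //.
by apply: contraNneq xs => <-.
Qed.

Variable T : 'End(V).
Hypothesis T_selfadj : forall x y, f (T x) y = f x (T y).

Lemma eigen_orthogonal a b x y : T x = a *: x -> T y = b *: y -> f x y != 0 -> a = b.
Proof.
move=> Tx Ty xy; have := T_selfadj x y.
by rewrite Tx Ty symZl symZr => /(mulIf xy).
Qed.

(** Removing components along eigenvectors does not leave the eigenspace of [x]:
by self-adjointness only members of [s] with the same eigenvalue pair with
[x]. *)
Lemma ortho_rest_eigen s a x :
  {in s, forall z, exists c, T z = c *: z} -> T x = a *: x ->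
  T (ortho_rest s x) = a *: ortho_rest s x.
Proof.
move=> es Tx; rewrite /ortho_rest linearB linear_sum /= Tx scalerBr scaler_sumr.
congr (_ - _).
rewrite !big_seq; apply: eq_bigr => z zs; rewrite linearZ /=.
have [c Tz] := es z zs; have [->|xz] := eqVneq (f x z) 0.
  by rewrite mul0r !scale0r scaler0.
by rewrite Tz (eigen_orthogonal Tx Tz xz) !scalerA mulrC.
Qed.

Hypothesis f_nondeg : nondegenerate f.
Hypothesis T_diag : diagonalizable_lfun T.
Hypothesis F2 : 2%:R != 0 :> F.

(** Some eigenvector [y] orthogonal to [s] is nonzero because the rests of an
eigenbasis complete the span of [s]. It may be isotropic, but nondegeneracy
gives a partner [y'] of the same kind with [f y y' != 0], necessarily for the
same eigenvalue, and then one of [y], [y'], [y + y'] is not isotropic. *)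
Lemma orthogonal_eigen_extend s :
  orthogonal_seq s -> {in s, forall z, exists c, T z = c *: z} ->
  << s >>%VS != fullv ->
  exists u, [/\ f u u != 0, exists a, T u = a *: u & {in s, forall z, f u z = 0}].
Proof.
move=> os es ns; have [b bb eb] := T_diag.
have [x xb px] : exists2 x, x \in b & ortho_rest s x != 0.
  apply: contrapT => nex; move/eqP: ns; apply; apply/eqP; rewrite eqEsubv subvf.
  rewrite -(span_basis bb); apply/span_subvP => x xb; apply: ortho_rest_span.
  by apply: contrapT => /eqP px; apply: nex; exists x.
set y := ortho_rest s x in px.
have [a Ty] : exists a, T y = a *: y.
  by have [a Tx] := eb x xb; exists a; exact: ortho_rest_eigen.
have ys := ortho_restP os.
have [x' xb' yx'] : exists2 x', x' \in b & f y x' != 0.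
  apply: contrapT => nex; move/eqP: px; apply.
  apply: (nondegP f).1 => // z.
  have /subvP/(_ z (memvf z))/mem_orthovP/(_ y (memv_line y)) :
      (fullv <= orthov f <[y]>)%VS.
    rewrite -(span_basis bb); apply/span_subvP => x' xb'.
    rewrite mem_orthov1 symC; apply: contrapT => H; apply: nex; exists x' => //.
    by apply/negP.
  by rewrite symC.
set y' := ortho_rest s x'.
have yy' : f y y' != 0.
  rewrite /y' /ortho_rest symBr sym_sumr big1_seq ?subr0 // => z /andP[_ zs].
  by rewrite symZr ys ?mulr0.
have [a' Ty'] : exists a, T y' = a *: y'.
  by have [a' Tx'] := eb x' xb'; exists a'; exact: ortho_rest_eigen.
have aa := eigen_orthogonal Ty Ty' yy'; rewrite -{}aa in Ty'.
have [yy0|] := eqVneq (f y y) 0; last first.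
  by exists y; split => //; [exists a|move=> z zs; exact: ys].
have [yy0'|] := eqVneq (f y' y') 0; last first.
  by exists y'; split => //; [exists a|move=> z zs; exact: ys].
exists (y + y'); split.
- clearbody y y'; rewrite symDl !symDr yy0 yy0' (symC _ y') add0r addr0.
  rewrite -mulr2n -mulr_natl.
  by rewrite mulf_neq0.
- by exists a; clearbody y y'; rewrite linearD /= Ty Ty' scalerDr.
- by move=> z zs; rewrite symDl [f y z]ys ?[f y' z]ys ?addr0.
Qed.

End OrthogonalFamilies.

(** Gram-Schmidt inside the eigenspaces: an orthogonal family of unit eigenvectors
that does not span can be enlarged, and its size is bounded by the dimension. *)
Lemma orthonormal_eigenbasis (R : rcfType) (V : vectType R) (f : {symmetric V})
    (T : 'End(V)) :
  (forall x y, f (T x) y = f x (T y)) -> nondegenerate f ->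
  diagonalizable_lfun T ->
  exists s : seq V, [/\ basis_of fullv s, {in s, forall z, exists c, T z = c *: z},
    {in s &, forall x y, x != y -> f x y = 0}
    & {in s, forall x, f x x = 1 \/ f x x = -1}].
Proof.
move=> Tsa fnd Td.
suff [s [[us os ns] es norms sp]] : exists s : seq V,
  [/\ orthogonal_seq f s, {in s, forall z, exists c, T z = c *: z},
      {in s, forall x, f x x = 1 \/ f x x = -1} & << s >>%VS = fullv].
  exists s; split=> //; rewrite basisEfree (@orthogonal_seq_free _ _ f) //.
  by rewrite subvf -sp dim_span.
have [k] := ubnP (\dim {:V} - size (Nil V)).
have : [/\ orthogonal_seq f [::], {in [::], forall z, exists c, T z = c *: z}
         & {in [::], forall x, f x x = 1 \/ f x x = -1}] by [].
elim: k (Nil V) => [//|k IH] s [os es ns] ltk.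
have [sp|nsp] := eqVneq << s >>%VS fullv; first by exists s.
have two0 : 2%:R != 0 :> R by rewrite pnatr_eq0.
have [u [uu [a Tu] us]] := orthogonal_eigen_extend Tsa fnd Td two0 os es nsp.
(* Normalization; the sign of [f u u] survives as the value [1] or [-1]. *)
pose v := (Num.sqrt `|f u u|)^-1 *: u.
have n0 : `|f u u| != 0 by rewrite normr_eq0.
have vv : f v v = Num.sg (f u u).
  rewrite symZl symZr mulrA -invfM -expr2 sqr_sqrtr //.
  by rewrite {2}[f u u]numEsg mulrCA mulVf ?mulr1.
have vs : {in s, forall z, f v z = 0} by move=> z zs; rewrite symZl us ?mulr0.
have vpm : f v v = 1 \/ f v v = -1.
  by rewrite vv; case: sgrP uu => // _ _; [left|right].
have vn : f v v != 0 by rewrite vv sgr_eq0.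
have osv : orthogonal_seq f (v :: s).
  have [usq osq nsq] := os; split => /=.
  - by rewrite usq andbT; apply: contra vn => /vs ->.
  - move=> x y; rewrite !inE => /orP[/eqP->|xs] /orP[/eqP->|ys] //;
      first by rewrite eqxx.
    + by rewrite vs.
    + by rewrite symC vs.
    + exact: osq.
  - by move=> x; rewrite inE => /orP[/eqP->|/nsq].
apply: (IH (v :: s)); first split => //.
- move=> z; rewrite inE => /orP[/eqP->|/es //]; exists a.
  by rewrite linearZ /= Tu !scalerA mulrC.
- by move=> z; rewrite inE => /orP[/eqP->|/ns].
- have := orthogonal_seq_free osv; rewrite /free => /eqP sz.
  have := dimvS (subvf << v :: s >>); rewrite sz /= => szle.
  by rewrite /=; apply: leq_trans (ltn_sub2l szle (ltnSn _)) _; rewrite -ltnS.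
Qed.

(** * Spectrum of an operator pairing two families of vectors *)

Import passmx.

(** Base change written with a rectangular [P], so that bases indexed by types of
provably equal sizes need no cast. *)
Lemma char_poly_conj (F : fieldType) m n (P : 'M[F]_(m, n)) M K :
  row_free P -> row_full P -> P *m M = K *m P -> char_poly M = char_poly K.
Proof.
move=> /eqP rf /eqP rF; have mn : m = n by rewrite -rf rF.
case: _ / mn in M P rf rF *; move=> PM.
have uP : \det (map_mx polyC P) != 0.
  have : row_free P by rewrite /row_free rf.
  by rewrite row_free_unit unitmxE unitfE det_map_mx polyC_eq0.
apply: (mulfI uP); rewrite /char_poly [RHS]mulrC -!det_mulmx; congr (\det _).
by rewrite /char_poly_mx mulmxBr mulmxBl -!map_mxM PM scalar_mxC.
Qed.

(** The four blocks of [X - K] commute, so the determinant is that of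
[X^2 - D]: multiplying on the right by a lower triangular block matrix of
determinant [det X] clears the lower left block. *)
Lemma char_poly_antidiag_block (F : fieldType) n (d : 'rV[F]_n) :
  char_poly (block_mx 0 1%:M (diag_mx d) 0) = \prod_i ('X^2 - (d 0 i)%:P).
Proof.
set K := block_mx _ _ _ _; pose x : 'M[{poly F}]_n := 'X%:M.
pose D : 'M[{poly F}]_n := map_mx polyC (diag_mx d).
have eK : char_poly_mx K = block_mx x (- 1%:M) (- D) x.
  rewrite /char_poly_mx /K map_block_mx !map_mx0 map_mx1 scalar_mx_block.
  by rewrite opp_block_mx add_block_mx !subr0 !sub0r.
have x0 : \det x != 0.
  by rewrite det_scalar expf_neq0 // polyX_eq0.
apply: (mulIf x0); rewrite /char_poly eK.
have -> : \det x = \det (block_mx x 0 D 1%:M) by rewrite det_lblock det1 mulr1.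
rewrite -det_mulmx mulmx_block !mulmx0 !mulmx1 !add0r mulNmx mul1mx.
rewrite mulNmx (_ : x *m D = D *m x) ?addNr; last first.
  by rewrite mul_scalar_mx mul_mx_scalar.
rewrite det_ublock det_lblock det1 mulr1; congr (_ * _).
have -> : x *m x - D = diag_mx (\row_i ('X^2 - (d 0 i)%:P)).
  rewrite -scalar_mxM -expr2 /D map_diag_mx -diag_const_mx -raddfB /=.
  congr diag_mx.
  by apply/rowP => i; rewrite !mxE.
by rewrite det_diag; apply: eq_bigr => i _; rewrite mxE.
Qed.

(** In the basis made of the [p i] followed by the [q i], the matrix of [A] is
antidiagonal by blocks. *)
Lemma char_poly_paired (R : realType) (V : vectType R) (A : 'End(V)) n
    (p q : 'I_n -> V) (mu : 'I_n -> R) :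
  (forall i, A (p i) = q i) -> (forall i, A (q i) = mu i *: p i) ->
  (forall c d : 'I_n -> R, \sum_i c i *: p i + \sum_i d i *: q i = 0 ->
     (forall i, c i = 0) /\ (forall i, d i = 0)) ->
  (forall x, exists c d : 'I_n -> R, x = \sum_i c i *: p i + \sum_i d i *: q i) ->
  char_poly_lfun A = \prod_i ('X^2 - (mu i)%:P).
Proof.
move=> Ap Aq fr sp; set e := vbasis {:V}.
have eB : basis_of {:V} e := vbasisP _.
pose P := \matrix_(i < n) rVof e (p i).
pose Q := \matrix_(i < n) rVof e (q i).
have PQ (u v : 'rV_n) : row_mx u v *m col_mx P Q =
    rVof e (\sum_i u 0 i *: p i + \sum_i v 0 i *: q i).
  rewrite mul_row_col !mulmx_sum_row linearD !linear_sum; congr (_ + _);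
  by apply: eq_bigr => i _; rewrite linearZ rowK.
rewrite /char_poly_lfun (@char_poly_conj _ _ _ (col_mx P Q) _
  (block_mx 0 1%:M (diag_mx (\row_i mu i)) 0)).
- by rewrite char_poly_antidiag_block; apply: eq_bigr => i _; rewrite mxE.
- apply: inj_row_free => u; rewrite -[u]hsubmxK PQ => /eqP.
  rewrite rVof_eq0 // => /eqP/fr[u0 v0].
  rewrite -[RHS]row_mx0.
  by congr row_mx; apply/rowP => i; rewrite [RHS]mxE ?u0 ?v0.
- rewrite -sub1mx; apply/row_subP => i.
  have [c [d E]] := sp (vecof e (row i 1%:M)).
  apply/submxP; exists (row_mx (\row_i c i) (\row_i d i)).
  rewrite PQ; under eq_bigr do rewrite mxE.
  under [X in _ + X]eq_bigr do rewrite mxE.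
  by rewrite -E vecofK.
- rewrite mul_col_mx mul_block_col !mul0mx add0r addr0 mul1mx; congr col_mx.
    by apply/row_matrixP => i; rewrite row_mul !rowK -rVof_app // Ap.
  apply/row_matrixP => i; rewrite row_mul !rowK -rVof_app // Aq.
  by rewrite row_mul row_diag_mx -scalemxAl -rowE rowK mxE linearZ.
Qed.

Definition csqrt (R : realType) (a : R) : R[i] :=
  if 0 <= a then (Num.sqrt a)%:C%C else (0 +i* Num.sqrt (- a))%C.

Lemma csqrtK (R : realType) (a : R) : csqrt a ^+ 2 = a%:C%C.
Proof.
rewrite /csqrt; case: ifPn => [a0|]; first by rewrite -rmorphXn /= sqr_sqrtr.
rewrite -ltNge => a0; rewrite expr2; simpc.
by rewrite -expr2 sqr_sqrtr ?opprK // oppr_ge0 ltW.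
Qed.

(** Each factor [X^2 - mu i] contributes a pair of opposite square roots: real for
positive [mu i], purely imaginary for negative [mu i]. *)
Lemma williamson_paired (R : realType) (V : vectType R) (A : 'End(V)) n
    (mu : 'I_n -> R) :
  (forall i, mu i != 0) ->
  char_poly_lfun A = \prod_i ('X^2 - (mu i)%:P) ->
  williamson_spectrum A (\sum_i (mu i < 0)%R)%N (\sum_i (0 < mu i)%R)%N 0.
Proof.
move=> mu0 cA; pose r i := csqrt (mu i).
have sgn i : r i = if 0 < mu i then (Num.sqrt (mu i))%:C%C
                   else (0 +i* Num.sqrt (- mu i))%C.
  by rewrite /r /csqrt le0r (negPf (mu0 i)).
have sq i : Num.sqrt (if 0 < mu i then mu i else - mu i) != 0.
  rewrite sqrtr_eq0 -ltNge; have := mu0 i.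
  by case: (ltrgtP 0 (mu i)) => [//|h _|<- /eqP//]; rewrite oppr_gt0.
pose s := [seq r i | i <- enum 'I_n] ++ [seq - r i | i <- enum 'I_n].
have cs (P : pred R[i]) (Q : pred R) : (forall i, P (r i) = Q (mu i)) ->
    (forall z, P (- z) = P z) -> count P s = (2 * \sum_i Q (mu i))%N.
  have cE (a : pred 'I_n) : count a (enum 'I_n) = (\sum_i a i)%N.
    rewrite -sum1_count big_mkcond /= big_enum /=.
    by apply: eq_bigr => i _; case: (a i).
  move=> PQ PN; rewrite count_cat (count_map r) cE.
  rewrite (count_map (fun i => - r i)) cE mul2n -addnn.
  by congr (_ + _)%N; apply: eq_bigr => i _; rewrite /= ?PN PQ.
exists s; split.
- rewrite cA rmorph_prod big_cat /= (big_map r) (big_map (fun i => - r i)).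
  rewrite !big_enum /= -big_split /=; apply: eq_bigr => i _.
  rewrite rmorphB /= map_polyXn map_polyC /= -csqrtK.
  by rewrite polyCN opprK rmorphXn -subr_sqr.
- apply/negP => /[!mem_cat]/orP[]/mapP[i _ /esym/eqP]; rewrite ?oppr_eq0 sgn;
    have := sq i; case: ifP => _;
    by rewrite eq_complex /= ?eqxx ?andbT => /negPf ->.
- apply: (cs _ (fun a => a < 0)) => [i|z]; last first.
    by case: z => a b /=; rewrite oppr_eq0.
  rewrite sgn; have := sq i; have := mu0 i.
  by case: (ltrgtP 0 (mu i)) => /= [_ _ H|_ _ H|<- /eqP //];
    rewrite ?eqxx ?(negPf H).
- apply: (cs _ (fun a => 0 < a)) => [i|z]; last first.
    by case: z => a b /=; rewrite oppr_eq0.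
  rewrite sgn; have := sq i; have := mu0 i.
  by case: (ltrgtP 0 (mu i)) => /= [_ _ H|_ _ H|<- /eqP //];
    rewrite ?eqxx ?(negPf H).
- rewrite (cs _ pred0) ?big1 // => [i|z]; last first.
    by case: z => a b /=; rewrite !oppr_eq0.
  by rewrite sgn; case: ifP => _ /=; rewrite eqxx ?andbF.
Qed.

(** * Euler-Arnold equations on coadjoint orbits *)

(** Leibniz rule. Velocities are tested on linear forms, so the product rule is
applied to the coordinate functions of the curve. *)
Lemma velocity_bilinear (R : realType) (L : vectType R) (beta : L -> L -> L)
    (c : R -> L) t v :
  (forall x, linear (beta x)) -> (forall y, linear (beta^~ y)) ->
  is_velocity c t v ->
  is_velocity (fun s => beta (c s) (c s)) t (beta v (c t) + beta (c t) v).
Proof.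
move=> lr ll cv phi; pose e := vbasis {:L}; set n := \dim {:L}.
pose x i s := coord e i (c s).
have betaE u w : phi (beta u w) =
    \sum_(i < n) \sum_(j < n) (coord e i u * coord e j w) * phi (beta e`_i e`_j).
  pose betal y : {linear L -> L} :=
    HB.pack (beta^~ y) (GRing.isLinear.Build _ _ _ _ _ (ll y)).
  pose betar y : {linear L -> L} :=
    HB.pack (beta y) (GRing.isLinear.Build _ _ _ _ _ (lr y)).
  rewrite {1}(coord_vbasis (memvf u)) -[beta _ w]/(betal w _) !linear_sum.
  apply: eq_bigr => i _; rewrite !linearZ /= {1}(coord_vbasis (memvf w)).
  rewrite -[beta _ _]/(betar _ _) !linear_sum.
  by apply: eq_bigr => j _; rewrite 2!linearZ /= scalerA.
have dx i : is_derive t (1 : R) (x i) (coord e i v).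
  have E : x i = (fun s => linfun (coord e i : L -> R^o) (c s)).
    by apply/funext => s; rewrite lfunE.
  rewrite E; have -> : coord e i v = linfun (coord e i : L -> R^o) v.
    by rewrite lfunE.
  exact: cv.
have -> : (fun s => phi (beta (c s) (c s)) : R) =
  \sum_(i < n) \sum_(j < n) ((x i * x j) * cst (phi (beta e`_i e`_j))).
  apply/funext => s; rewrite betaE fct_sumE; apply: eq_bigr => i _.
  by rewrite fct_sumE; apply: eq_bigr => j _.
apply: is_derive_eq.
rewrite linearD /= !betaE -big_split; apply: eq_bigr => i _.
rewrite -big_split; apply: eq_bigr => j _; rewrite scaler0 add0r /x /=.
rewrite -![_ *: _]/(_ * _) /cst; set a := phi _; ring.
Qed.

(** Throughout this section the vector field is [P |-> coad P P], the Euler-Arnold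
field of a Lie algebra with a nondegenerate form; the orbit through [P] has
tangent vectors [coad U P]. *)
Section EulerArnold.
Variables (R : realType) (L : vectType R) (br : {bilinear L -> L -> L}).
Hypothesis br_alt : forall x, br x x = 0.
Variable ip : {symmetric L}.
Hypothesis ip_nondeg : nondegenerate ip.

Lemma brDl x y z : br (x + y) z = br x z + br y z. Proof. exact: linearDl. Qed.
Lemma brDr x y z : br z (x + y) = br z x + br z y. Proof. exact: linearDr. Qed.

Lemma brC x y : br x y = - br y x.
Proof.
have := br_alt (x + y); rewrite brDl !brDr !br_alt addr0 add0r => /eqP.
by rewrite addr_eq0 => /eqP.
Qed.

Lemma coadE U P y : ip (coad br ip U P) y = ip P (br U y).
Proof. by rewrite transposeE // lfunE. Qed.

Lemma coad_linearl P : linear (fun U => coad br ip U P).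
Proof.
move=> a U U'; apply: (nondeg_eq ip_nondeg) => y.
by rewrite symDl symZl !coadE linearPl symDr symZr.
Qed.

Lemma coad_linearr U : linear (coad br ip U).
Proof.
move=> a P P'; apply: (nondeg_eq ip_nondeg) => y.
by rewrite symDl symZl !coadE symDl symZl.
Qed.

Lemma linfun_coadE U P : linfun ((coad br ip)^~ P) U = coad br ip U P.
Proof. by rewrite linfunE //; exact: coad_linearl. Qed.

Lemma orbit_tangentP P xi :
  reflect (exists U, xi = coad br ip U P) (xi \in orbit_tangent br ip P).
Proof.
apply: (iffP memv_imgP) => [[U _ ->]|[U ->]]; first by exists U; rewrite linfun_coadE.
by exists U; rewrite ?memvf // linfun_coadE.
Qed.

Lemma coad_invK P xi : xi \in orbit_tangent br ip P ->
  coad br ip ((linfun ((coad br ip)^~ P))^-1%VF xi) P = xi.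
Proof. by move=> /limg_lfunVK; rewrite linfun_coadE. Qed.

Lemma coad_skew P U V : ip (coad br ip U P) V = - ip (coad br ip V P) U.
Proof. by rewrite !coadE brC symNr. Qed.

(** The choice of preimage in the definition of the orbit form is harmless: the
pairing of [coad V P] with [U] depends on [coad U P] only. *)
Lemma orbit_form_coad P U eta : eta \in orbit_tangent br ip P ->
  orbit_form br ip P (coad br ip U P) eta = ip eta U.
Proof.
move=> etaT; have xiT : coad br ip U P \in orbit_tangent br ip P.
  by apply/orbit_tangentP; exists U.
by rewrite /orbit_form -coadE coad_invK // coad_skew opprK coad_invK.
Qed.

Variable G : lie_group br.

(** By [orbit_form_coad] the form evaluated on [coad P P] and [xi] is [ip xi P],
which is the differential of half the square norm; the same formula gives
nondegeneracy, as [coad V P] for arbitrary [V] exhausts the tangent space. *)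
Lemma euler_hamiltonian (X : L -> L) Y :
  (forall P, X P = coad br ip P P) ->
  hamiltonian_on_orbit ip G (fun P => 2^-1 * ip P P) X Y.
Proof.
move=> XE P _; split.
- by rewrite XE; apply/orbit_tangentP; exists P.
- move=> xi /orbit_tangentP[U ->] H; apply: (nondegP ip).1 => // V.
  have VT : coad br ip V P \in orbit_tangent br ip P.
    by apply/orbit_tangentP; exists V.
  by rewrite coad_skew -(orbit_form_coad U VT) H ?oppr0.
- move=> xi xiT; rewrite XE orbit_form_coad // symC.
  have -> : (fun t : R => 2^-1 * ip (P + t *: xi) (P + t *: xi)) =
     cst (2^-1 * ip P P) + (ip P xi) \*: (@id R)
       + (2^-1 * ip xi xi) \*: (@id R ^+ 2).
    apply/funext => t; rewrite !fctE /=.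
    rewrite symDl !symDr !symZl !symZr (symC ip xi P) -![_ *: _]/(_ * _).
    by set a := ip P P; set b := ip P xi; set c := ip xi xi; field.
  apply: is_derive_eq.
  by rewrite -![_ *: _]/(_ * _) /=; ring.
Qed.

Lemma coAd_E (q : G) P y : ip (coAd ip q P) y = ip P (lg_Ad q y).
Proof. exact: transposeE. Qed.

Lemma lg_exp0 : lg_exp G 0 = 1%g.
Proof.
have := lg_expD G 0 0 0; rewrite addr0 scale0r => E.
by apply: (mulgI (lg_exp G 0)); rewrite mulg1 -E.
Qed.

(** Any linear form is the pairing with some [a], which moves the group action from
[Y] to [a], where its derivative is known. *)
Lemma coAd_exp_velocity U Y :
  is_velocity (fun t : R => coAd ip (lg_exp G (t *: U)) Y) 0 (coad br ip U Y).
Proof.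
move=> phi; have [|a Ha] := riesz_exists ip_nondeg (phi := phi).
  by move=> k u v; rewrite linearP.
have E x : phi x = ip x a by rewrite -Ha symC.
have -> : (fun s : R => phi (coAd ip (lg_exp G (s *: U)) Y) : R) =
  fun s : R => linfun (ip Y : L -> R^o) (lg_Ad (lg_exp G (s *: U)) a).
  by apply/funext => s; rewrite E coAd_E lfunE.
have -> : phi (coad br ip U Y) = linfun (ip Y : L -> R^o) (br U a).
  by rewrite E coadE lfunE.
exact: lg_dAd.
Qed.

(** The field is the restriction to the diagonal of a bilinear map, so its
derivative along the orbit is the sum of two terms. *)
Lemma euler_linearization (X : L -> L) Y
    (A : 'End(subvs_of (orbit_tangent br ip Y))) :
  (forall P, X P = coad br ip P P) ->
  (forall xi,
     vsval (A xi) = coad br ip (vsval xi) Y + coad br ip Y (vsval xi)) ->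
  is_orbit_linearization G X A.
Proof.
move=> XE AE U xi xiE c.
have cv : is_velocity c 0 (vsval xi) by rewrite xiE; exact: coAd_exp_velocity.
have c0 : c 0 = Y.
  apply: (nondeg_eq ip_nondeg) => y.
  by rewrite /c coAd_E scale0r lg_exp0 lg_Ad1 id_lfunE.
split=> //; have -> : X \o c = (fun s => coad br ip (c s) (c s)).
  by apply/funext => s /=; rewrite XE.
have := velocity_bilinear coad_linearr coad_linearl cv.
by rewrite c0 -AE.
Qed.

End EulerArnold.

(** * Orthogonal splitting of a Heisenberg-Reiter algebra *)

Lemma nondeg_restrP (F : fieldType) (V : vectType F) (f : {symmetric V})
    (U : {vspace V}) :
  nondegenerate (restr f U) <->
  {in U, forall x, {in U, forall y, f x y = 0} -> x = 0}.
Proof.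
split=> [/nondegP nd x xU x0|H].
  rewrite -(vsprojK xU); have -> : vsproj U x = 0.
    by apply: nd => y; rewrite /= /restr vsprojK // x0 // subvsP.
  by rewrite linear0.
apply/nondegP => x x0; apply: val_inj; rewrite linear0; apply: H; first exact: subvsP.
by move=> y yU; rewrite -(vsprojK yU); exact: x0.
Qed.

(** The orthogonal projection of [x] on [U] is the vector of [U] representing the
pairing with [x]. *)
Lemma nondeg_addv_ortho (F : fieldType) (V : vectType F) (f : {symmetric V})
    (U : {vspace V}) :
  nondegenerate (restr f U) -> (U + orthov f U = fullv)%VS.
Proof.
move=> nd; apply/eqP; rewrite eqEsubv subvf; apply/subvP => x _.
have [|y Hy] := riesz_exists nd (phi := fun y => f x (vsval y)).
  by move=> a u v; exact: symPr.
rewrite -(subrKC (vsval y) x); apply: memv_add; first exact: subvsP.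
apply/mem_orthovP => z zU; have := Hy (vsproj U z).
by rewrite /= /restr vsprojK // => E; rewrite symBl E subrr.
Qed.

Section HeisenbergReiterAlgebra.
Variables (R : realType) (u1 u2 w : vectType R) (B : {bilinear u1 -> u2 -> w}).
Local Notation g := (u1 * u2 * w)%type.

Fact hr_bracket_bilinear : bilinear_for *:%R *:%R (hr_bracket B).
Proof.
split=> U a x y; rewrite /hr_bracket; congr (_, _, _); rewrite /= ?scaler0 ?addr0 //.
  by rewrite linearPl linearPr scalerBr opprD addrACA.
by rewrite linearPr linearPl scalerBr opprD addrACA.
Qed.

HB.instance Definition _ :=
  bilinear_isBilinear.Build R g g g *:%R *:%R (hr_bracket B) hr_bracket_bilinear.

Lemma hr_bracket_alt x : hr_bracket B x x = 0.
Proof. by rewrite /hr_bracket subrr. Qed.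

Fact in_u1_linear : linear (@in_u1 R u1 u2 w).
Proof.
by move=> a x y; rewrite /in_u1; congr (_, _, _); rewrite /= scaler0 addr0.
Qed.
Fact in_u2_linear : linear (@in_u2 R u1 u2 w).
Proof.
by move=> a x y; rewrite /in_u2; congr (_, _, _); rewrite /= scaler0 addr0.
Qed.
Fact in_w_linear : linear (@in_w R u1 u2 w).
Proof.
by move=> a x y; rewrite /in_w; congr (_, _, _); rewrite /= scaler0 addr0.
Qed.
HB.instance Definition _ := GRing.isLinear.Build _ _ _ _ _ in_u1_linear.
HB.instance Definition _ := GRing.isLinear.Build _ _ _ _ _ in_u2_linear.
HB.instance Definition _ := GRing.isLinear.Build _ _ _ _ _ in_w_linear.

Lemma hr_split (x : g) : x = in_u1 u2 w x.1.1 + in_u2 u1 w x.1.2 + in_w u1 u2 x.2.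
Proof.
case: x => [[x y] c]; rewrite /in_u1 /in_u2 /in_w.
by congr (_, _, _); rewrite /= ?addr0 ?add0r.
Qed.

Lemma mem_hr_u1 (x : g) : x \in hr_u1 u1 u2 w -> x = in_u1 u2 w x.1.1.
Proof. by move=> /memv_imgP[y _ ->]; rewrite lfunE. Qed.
Lemma mem_hr_u2 (x : g) : x \in hr_u2 u1 u2 w -> x = in_u2 u1 w x.1.2.
Proof. by move=> /memv_imgP[y _ ->]; rewrite lfunE. Qed.
Lemma in_u1_mem x : in_u1 u2 w x \in hr_u1 u1 u2 w.
Proof. by apply/memv_imgP; exists x; rewrite ?memvf ?lfunE. Qed.
Lemma in_u2_mem x : in_u2 u1 w x \in hr_u2 u1 u2 w.
Proof. by apply/memv_imgP; exists x; rewrite ?memvf ?lfunE. Qed.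
Lemma in_w_mem x : in_w u1 u2 x \in hr_w u1 u2 w.
Proof. by apply/memv_imgP; exists x; rewrite ?memvf ?lfunE. Qed.

Lemma mem_hr_z (z : g) : reflect
  ((forall y, B z.1.1 y = 0) /\ (forall x, B x z.1.2 = 0)) (z \in hr_z B).
Proof.
have ker1 x : (x \in lker (linfun (fun x : u1 => linfun (B x)))) =
    (linfun (B x) == 0).
  have l : linear (fun x : u1 => linfun (B x)).
    move=> a x1 x2; apply/lfunP => y.
    by rewrite !lfunE /= !lfunE /= linearPl lfunE.
  by rewrite memv_ker linfunE.
have ker2 y : (y \in lker (linfun (fun y : u2 => linfun (B^~ y)))) =
    (linfun (B^~ y) == 0).
  have l : linear (fun y : u2 => linfun (applyr B y)).
    move=> a y1 y2; apply/lfunP => x.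
    by rewrite !lfunE /= !lfunE /= linearPr lfunE.
  by rewrite memv_ker linfunE.
apply: (iffP idP) => [|[B1 B2]].
  move=> /memv_addP[_ /memv_addP[_ /memv_imgP[x xk ->] [_ /memv_imgP[y yk ->] ->]]].
  move=> [_ /memv_imgP[c _ ->] ->]; rewrite !lfunE /= !(addr0, add0r).
  rewrite ker1 in xk; rewrite ker2 in yk; split=> [y'|x'].
    by have /eqP/lfunP/(_ y') := xk; rewrite !lfunE.
  by have /eqP/lfunP/(_ x') := yk; rewrite (lfunE (applyr B y)) lfunE.
rewrite (hr_split z); apply: memv_add; last exact: in_w_mem.
apply: memv_add; apply/memv_imgP; [exists z.1.1|exists z.1.2]; rewrite ?lfunE //.
  by rewrite ker1; apply/eqP/lfunP => y; rewrite zero_lfunE lfunE /= B1.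
rewrite ker2; apply/eqP/lfunP => x.
by rewrite zero_lfunE (lfunE (applyr B _)) /= B2.
Qed.

Lemma in_w_z c : in_w u1 u2 c \in hr_z B.
Proof. by apply/mem_hr_z; split=> x /=; rewrite ?linear0l ?linear0r. Qed.

(** As for symmetric forms, the identities below are stated with [hr_bracket B] as
the head symbol, so that they can be used for rewriting. *)
Lemma bracketE x y : hr_bracket B x y = in_w u1 u2 (B x.1.1 y.1.2 - B y.1.1 x.1.2).
Proof. by []. Qed.

Lemma bracketDl x y z :
  hr_bracket B (x + y) z = hr_bracket B x z + hr_bracket B y z.
Proof. exact: linearDl. Qed.

Lemma bracketDr x y z :
  hr_bracket B z (x + y) = hr_bracket B z x + hr_bracket B z y.
Proof. exact: linearDr. Qed.

Lemma bracket_zl z x : z \in hr_z B -> hr_bracket B z x = 0.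
Proof. by move=> /mem_hr_z[Bl Br]; rewrite bracketE Bl Br subrr. Qed.

Lemma bracket_zr z x : z \in hr_z B -> hr_bracket B x z = 0.
Proof. by move=> /mem_hr_z[Bl Br]; rewrite bracketE Bl Br subrr. Qed.

Variable ip : {symmetric g}.
Hypothesis H : hr_scalar_product B ip.

Let nd := hr_ip_nondeg H.

Lemma hr_coadE U P y : ip (coad (hr_bracket B) ip U P) y = ip P (hr_bracket B U y).
Proof. exact: coadE. Qed.

Lemma ip_u1u2 x y : ip (in_u1 u2 w x) (in_u2 u1 w y) = 0.
Proof. by apply: (orthovP (hr_ip_u12 H)); [exact: in_u1_mem|exact: in_u2_mem]. Qed.
Lemma ip_u1w x y : ip (in_u1 u2 w x) (in_w u1 u2 y) = 0.
Proof. by apply: (orthovP (hr_ip_u1w H)); [exact: in_u1_mem|exact: in_w_mem]. Qed.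
Lemma ip_u2w x y : ip (in_u2 u1 w x) (in_w u1 u2 y) = 0.
Proof. by apply: (orthovP (hr_ip_u2w H)); [exact: in_u2_mem|exact: in_w_mem]. Qed.

Lemma ip_in_u1 x y : ip (in_u1 u2 w x) y = ip (in_u1 u2 w x) (in_u1 u2 w y.1.1).
Proof. by rewrite {1}(hr_split y) !symDr ip_u1u2 ip_u1w !addr0. Qed.
Lemma ip_in_u2 x y : ip (in_u2 u1 w x) y = ip (in_u2 u1 w x) (in_u2 u1 w y.1.2).
Proof.
rewrite {1}(hr_split y) !symDr (symC ip _ (in_u1 _ _ _)).
by rewrite ip_u1u2 ip_u2w add0r addr0.
Qed.
Lemma ip_in_w c y : ip (in_w u1 u2 c) y = ip (in_w u1 u2 c) (in_w u1 u2 y.2).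
Proof.
rewrite {1}(hr_split y) !symDr (symC ip _ (in_u1 _ _ _)).
by rewrite (symC ip _ (in_u2 _ _ _)) ip_u1w ip_u2w !add0r.
Qed.

Lemma ip_vz v z : v \in hr_v B ip -> z \in hr_z B -> ip v z = 0.
Proof. by move=> /mem_orthovP; apply. Qed.

(** The centre contains [w], on which the form is nondegenerate. *)
Lemma hr_v_w v : v \in hr_v B ip -> v.2 = 0.
Proof.
move=> vv; have /nondeg_restrP/(_ (in_w u1 u2 v.2) (in_w_mem _)) E := hr_ip_w H.
have /(congr1 snd) // : in_w u1 u2 v.2 = 0.
apply: E => _ /memv_imgP[c _ ->]; rewrite lfunE /= symC -ip_in_w symC.
by rewrite (ip_vz vv) ?in_w_z.
Qed.

(** The centre is the sum of its intersections with the three orthogonal summands,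
so the components of a vector orthogonal to it are again orthogonal to it. *)
Lemma hr_v1_mem v : v \in hr_v B ip -> in_u1 u2 w v.1.1 \in hr_v1 B ip.
Proof.
move=> vv; rewrite memv_cap in_u1_mem andbT; apply/mem_orthovP => z /mem_hr_z[Bl Br].
rewrite ip_in_u1 symC -ip_in_u1 symC (ip_vz vv) //.
by apply/mem_hr_z; split=> // x; rewrite /= linear0r.
Qed.

Lemma hr_v2_mem v : v \in hr_v B ip -> in_u2 u1 w v.1.2 \in hr_v2 B ip.
Proof.
move=> vv; rewrite memv_cap in_u2_mem andbT; apply/mem_orthovP => z /mem_hr_z[Bl Br].
rewrite ip_in_u2 symC -ip_in_u2 symC (ip_vz vv) //.
by apply/mem_hr_z; split=> // x; rewrite /= linear0l.
Qed.

Lemma hr_v_split v : v \in hr_v B ip -> v = in_u1 u2 w v.1.1 + in_u2 u1 w v.1.2.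
Proof. by move=> /hr_v_w v0; rewrite {1}(hr_split v) v0 linear0 addr0. Qed.

Lemma hr_v1P v : v \in hr_v1 B ip -> v \in hr_v B ip /\ v = in_u1 u2 w v.1.1.
Proof. by rewrite memv_cap => /andP[? /mem_hr_u1]. Qed.
Lemma hr_v2P v : v \in hr_v2 B ip -> v \in hr_v B ip /\ v = in_u2 u1 w v.1.2.
Proof. by rewrite memv_cap => /andP[? /mem_hr_u2]. Qed.

Lemma nondeg_v : nondegenerate (restr ip (hr_v B ip)).
Proof.
apply/nondeg_restrP => v vv v0; rewrite (hr_v_split vv).
have -> : in_u1 u2 w v.1.1 = 0.
  apply: ((nondeg_restrP _ _).1 (hr_ip_v1 H)) (hr_v1_mem vv) _ => y /hr_v1P[yv yE].
  by rewrite yE symC -ip_in_u1 -yE symC v0.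
have -> : in_u2 u1 w v.1.2 = 0; last by rewrite addr0.
apply: ((nondeg_restrP _ _).1 (hr_ip_v2 H)) (hr_v2_mem vv) _ => y /hr_v2P[yv yE].
by rewrite yE symC -ip_in_u2 -yE symC v0.
Qed.

Lemma capv_z : (hr_v B ip :&: hr_z B = 0)%VS.
Proof.
apply/eqP; rewrite -subv0; apply/subvP => x; rewrite memv_cap memv0 => /andP[xv xz].
apply/eqP; apply: ((nondeg_restrP _ _).1 nondeg_v) => // y yv.
by rewrite symC ip_vz.
Qed.

(** A central vector orthogonal to the centre lies in the intersection of [v] with
the centre. *)
Lemma nondeg_z : nondegenerate (restr ip (hr_z B)).
Proof.
apply/nondeg_restrP => x xz x0; apply/eqP; rewrite -memv0 -capv_z memv_cap xz andbT.
by apply/mem_orthovP.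
Qed.

Lemma addv_z : (hr_v B ip + hr_z B = fullv)%VS.
Proof. by rewrite addvC; apply: nondeg_addv_ortho nondeg_z. Qed.

Lemma hr_pi_add P :
  daddv_pi (hr_v B ip) (hr_z B) P + daddv_pi (hr_z B) (hr_v B ip) P = P.
Proof. by rewrite daddv_pi_add ?capv_z // addv_z memvf. Qed.

Lemma hr_jE Z (x y : subvs_of (hr_v B ip)) :
  ip (vsval (hr_j B ip Z x)) (vsval y) = ip Z (hr_bracket B (vsval x) (vsval y)).
Proof.
have l1 (x' : subvs_of (hr_v B ip)) : linear (fun y' : subvs_of (hr_v B ip) =>
    ip Z (hr_bracket B (vsval x') (vsval y')) : R^o).
  by move=> a u v; rewrite vsval_is_linear linearPr symPr.
have l2 (y' : subvs_of (hr_v B ip)) : linear (fun x' : subvs_of (hr_v B ip) =>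
    ip Z (hr_bracket B (vsval x') (vsval y')) : R^o).
  by move=> a u v; rewrite vsval_is_linear linearPl symPr.
exact: (linfun_rieszE nondeg_v l1 l2).
Qed.

(** The Lie-Poisson field is an Euler-Arnold field: brackets with
central vectors vanish, and brackets are central, hence orthogonal to [v]. *)
Lemma lie_poisson_coad P : lie_poisson B ip P = coad (hr_bracket B) ip P P.
Proof.
apply: (nondeg_eq nd) => y; rewrite hr_coadE /lie_poisson -[y in LHS]hr_pi_add symDr.
rewrite [X in _ + X](ip_vz (subvsP _) (memv_pi _ _ _)) addr0.
rewrite -{1}(vsprojK (memv_pi (hr_v B ip) (hr_z B) y)) hr_jE !vsprojK ?memv_pi //.
rewrite -[P in RHS]hr_pi_add -[y in RHS]hr_pi_add bracketDl !bracketDr.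
set Pv := daddv_pi (hr_v B ip) _ P; set Pz := daddv_pi (hr_z B) _ P.
set yv := daddv_pi (hr_v B ip) _ y; set yz := daddv_pi (hr_z B) _ y.
have Pvv : Pv \in hr_v B ip by exact: memv_pi.
have Pzz : Pz \in hr_z B by exact: memv_pi.
have yzz : yz \in hr_z B by exact: memv_pi.
move: Pv Pz yv yz Pvv Pzz yzz => Pv Pz yv yz Pvv Pzz yzz.
rewrite (bracket_zr _ yzz) !(bracket_zl _ Pzz) !addr0 symDl bracketE.
by rewrite [X in _ = X + _](ip_vz Pvv (in_w_z _)) add0r.
Qed.

Lemma hr_j12E W y (x : subvs_of (hr_v1 B ip)) :
  ip (vsval (hr_j12 B ip W y)) (vsval x) =
  ip (in_w u1 u2 W) (in_w u1 u2 (B (vsval x).1.1 (vsval y).1.2)).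
Proof.
have l1 (y' : subvs_of (hr_v2 B ip)) : linear (fun x' : subvs_of (hr_v1 B ip) =>
    ip (in_w u1 u2 W) (in_w u1 u2 (B (vsval x').1.1 (vsval y').1.2)) : R^o).
  by move=> a u v; rewrite vsval_is_linear /= linearPl linearP symPr.
have l2 (x' : subvs_of (hr_v1 B ip)) : linear (fun y' : subvs_of (hr_v2 B ip) =>
    ip (in_w u1 u2 W) (in_w u1 u2 (B (vsval x').1.1 (vsval y').1.2)) : R^o).
  by move=> a u v; rewrite vsval_is_linear /= linearPr linearP symPr.
exact: (linfun_rieszE (hr_ip_v1 H) l1 l2).
Qed.

Lemma hr_j21E W (y : subvs_of (hr_v2 B ip)) x :
  ip (vsval (hr_j21 B ip W x)) (vsval y) =
  ip (in_w u1 u2 W) (in_w u1 u2 (B (vsval x).1.1 (vsval y).1.2)).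
Proof.
have l2 (y' : subvs_of (hr_v2 B ip)) : linear (fun x' : subvs_of (hr_v1 B ip) =>
    ip (in_w u1 u2 W) (in_w u1 u2 (B (vsval x').1.1 (vsval y').1.2)) : R^o).
  by move=> a u v; rewrite vsval_is_linear /= linearPl linearP symPr.
have l1 (x' : subvs_of (hr_v1 B ip)) : linear (fun y' : subvs_of (hr_v2 B ip) =>
    ip (in_w u1 u2 W) (in_w u1 u2 (B (vsval x').1.1 (vsval y').1.2)) : R^o).
  by move=> a u v; rewrite vsval_is_linear /= linearPr linearP symPr.
exact: (linfun_rieszE (hr_ip_v2 H) l1 l2).
Qed.

Lemma hr_j_adj W y x :
  ip (vsval (hr_j12 B ip W y)) (vsval x) = ip (vsval (hr_j21 B ip W x)) (vsval y).
Proof. by rewrite hr_j12E hr_j21E. Qed.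

(** Only the pairing of [Y] with brackets matters for the coadjoint action, so that
[Y] enters through its component [W] in [w] alone. *)
Section Orbit.
Variables (Y : g) (W : w).
Hypothesis YW : forall c, ip Y (in_w u1 u2 c) = ip (in_w u1 u2 W) (in_w u1 u2 c).

Lemma coad_v1 x : coad (hr_bracket B) ip (vsval x) Y = vsval (hr_j21 B ip W x).
Proof.
apply: (nondeg_eq nd) => y; rewrite hr_coadE bracketE YW -[y in RHS]hr_pi_add.
have [xv xE] := hr_v1P (subvsP x).
have [jv jE] := hr_v2P (subvsP (hr_j21 B ip W x)).
have yv := memv_pi (hr_v B ip) (hr_z B) y.
have yz := memv_pi (hr_z B) (hr_v B ip) y.
rewrite symDr [X in _ = _ + X]ip_vz // addr0 jE ip_in_u2 -jE.
rewrite -(vsprojK (hr_v2_mem yv)) hr_j21E.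
rewrite vsprojK ?hr_v2_mem //= -[y in LHS]hr_pi_add xE /= linearDr linear0r subr0.
by have /mem_hr_z[_ ->] := yz; rewrite addr0.
Qed.

Lemma coad_v2 x : coad (hr_bracket B) ip (vsval x) Y = - vsval (hr_j12 B ip W x).
Proof.
apply: (nondeg_eq nd) => y; rewrite hr_coadE bracketE YW -[y in RHS]hr_pi_add.
have [xv xE] := hr_v2P (subvsP x).
have [jv jE] := hr_v1P (subvsP (hr_j12 B ip W x)).
have yv := memv_pi (hr_v B ip) (hr_z B) y.
have yz := memv_pi (hr_z B) (hr_v B ip) y.
rewrite symNl symDr [X in _ = - (_ + X)]ip_vz // addr0 jE ip_in_u1 -jE.
rewrite -(vsprojK (hr_v1_mem yv)) hr_j12E.
rewrite vsprojK ?hr_v1_mem //= -[y in LHS]hr_pi_add xE /= linear0l sub0r.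
by rewrite linearDl; have /mem_hr_z[-> _] := yz; rewrite addr0 linearN symNr.
Qed.

End Orbit.
End HeisenbergReiterAlgebra.

(** * Linearization at an equilibrium and its spectrum *)

Section Spectrum.
Variables (R : realType) (u1 u2 w : vectType R) (B : {bilinear u1 -> u2 -> w}).
Local Notation g := (u1 * u2 * w)%type.
Variable ip : {symmetric g}.
Hypothesis H : hr_scalar_product B ip.

Lemma v1_orth_v2 (x : subvs_of (hr_v1 B ip)) (y : subvs_of (hr_v2 B ip)) :
  ip (vsval x) (vsval y) = 0.
Proof. by rewrite (hr_v1P (subvsP x)).2 (hr_v2P (subvsP y)).2 (ip_u1u2 H). Qed.

Variables (Y : g) (W : w).
Hypothesis YW : forall c, ip Y (in_w u1 u2 c) = ip (in_w u1 u2 W) (in_w u1 u2 c).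
Local Notation Phi := (hr_j12 B ip W).
Local Notation Psi := (hr_j21 B ip W).
Local Notation T := (orbit_tangent (hr_bracket B) ip Y).
Let nd := hr_ip_nondeg H.

Lemma coad_z U : U \in hr_z B -> coad (hr_bracket B) ip U Y = 0.
Proof.
move=> Uz; apply: (nondeg_eq nd) => y.
by rewrite (hr_coadE H) bracket_zl // sym0r sym0l.
Qed.

Lemma hr_coadD U V :
  coad (hr_bracket B) ip (U + V) Y =
    coad (hr_bracket B) ip U Y + coad (hr_bracket B) ip V Y.
Proof.
apply: (nondeg_eq nd) => y.
by rewrite symDl !(hr_coadE H) bracketDl symDr.
Qed.

Lemma tangent_mem U : coad (hr_bracket B) ip U Y \in T.
Proof. by apply/(orbit_tangentP _ nd); exists U. Qed.

Lemma hr_tangentP xi : xi \in T -> exists U, xi = coad (hr_bracket B) ip U Y.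
Proof. by move/(orbit_tangentP _ nd). Qed.

Lemma tangent_Psi_Phi xi :
  xi \in T -> exists x1 x2, xi = vsval (Psi x1) - vsval (Phi x2).
Proof.
move=> /hr_tangentP[U ->].
have := memv_pi (hr_v B ip) (hr_z B) U.
move: (memv_pi (hr_z B) (hr_v B ip) U) (hr_pi_add H U).
move: (daddv_pi _ _ U) (daddv_pi _ _ U) => Uv Uz Uzz <- Uvv.
exists (vsproj _ (in_u1 u2 w Uv.1.1)), (vsproj _ (in_u2 u1 w Uv.1.2)).
rewrite hr_coadD (coad_z Uzz) addr0 {1}(hr_v_split H Uvv) hr_coadD.
by rewrite -(coad_v1 H YW) -(coad_v2 H YW) !vsprojK ?hr_v1_mem ?hr_v2_mem.
Qed.

Lemma tangent_z xi z : xi \in T -> z \in hr_z B -> ip xi z = 0.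
Proof.
move=> /hr_tangentP[U ->] zz.
by rewrite (hr_coadE H) bracket_zr // sym0r.
Qed.

(** Tangent vectors are orthogonal to the centre, where brackets take their
values. This removes one of the two terms of the linearization. *)
Lemma coad_tangent xi : xi \in T -> coad (hr_bracket B) ip Y xi = 0.
Proof.
move=> xiT; apply: (nondeg_eq nd) => y.
by rewrite (hr_coadE H) sym0l bracketE tangent_z ?in_w_z.
Qed.

Lemma Psi_tangent x : vsval (Psi x) \in T.
Proof. by rewrite -(coad_v1 H YW) tangent_mem. Qed.
Lemma Phi_tangent x : - vsval (Phi x) \in T.
Proof. by rewrite -(coad_v2 H YW) tangent_mem. Qed.

(** The restriction of [j (Yz)]: for [U] in [v], [coad U Y] is [j (Yz) U]. *)
Definition hr_linearization : 'End(subvs_of T) :=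
  linfun (fun xi : subvs_of T => vsproj T (coad (hr_bracket B) ip (vsval xi) Y)).

Lemma hr_linearizationE xi :
  vsval (hr_linearization xi) = coad (hr_bracket B) ip (vsval xi) Y.
Proof.
have l : linear (fun xi : subvs_of T => vsproj T (coad (hr_bracket B) ip (vsval xi) Y)).
  by move=> a x y; rewrite vsval_is_linear (coad_linearl _ nd) linearP.
by rewrite linfunE // vsprojK ?tangent_mem.
Qed.

Variables (b : (\dim (hr_v2 B ip)).-tuple (subvs_of (hr_v2 B ip)))
  (lam : 'I_(\dim (hr_v2 B ip)) -> R).
Hypothesis Hb : adapted_eigenbasis W b lam.
Hypothesis Phi_nd : nondegenerate (restr (restr ip (hr_v1 B ip)) (limg Phi)).

Let e i : g := vsval (tnth b i).
Let f i : g := vsval (Phi (tnth b i)).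

Lemma Psi_Phi i : Psi (Phi (tnth b i)) = lam i *: tnth b i.
Proof. by rewrite -(aeb_eigen Hb) comp_lfunE. Qed.

Lemma ip_ee i j : i != j -> ip (e i) (e j) = 0.
Proof. exact: (aeb_ortho Hb). Qed.

Lemma ip_ee_neq0 i : ip (e i) (e i) != 0.
Proof.
by case: (aeb_norm Hb i); rewrite /restr /e /= => ->; rewrite ?oppr_eq0 oner_eq0.
Qed.

Lemma ip_ff i j : ip (f i) (f j) = lam j * ip (e j) (e i).
Proof. by rewrite /f (hr_j_adj H) Psi_Phi linearZ symZl. Qed.

Lemma ip_fe i j : ip (f i) (e j) = 0.
Proof. exact: v1_orth_v2. Qed.

(** The vector [Phi (b i)] is always in the image of [Phi], and for [lam i = 0] it
is orthogonal to that image, since [Psi (Phi (b i)) = 0]; here the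
nondegeneracy of the image is used. *)
Lemma lam0_Phi i : lam i = 0 -> Phi (tnth b i) = 0.
Proof.
move=> l0; apply: ((nondeg_restrP _ _).1 Phi_nd); first by rewrite memv_img ?memvf.
move=> _ /memv_imgP[x _ ->].
have := hr_j_adj H W x (Phi (tnth b i)); rewrite Psi_Phi l0 scale0r linear0 sym0l.
by rewrite symC.
Qed.

Let I := [set i | lam i != 0].
(** A candidate basis of the tangent space. Zero eigenvalues are left out: then
[Phi (b i)] vanishes and [b i], orthogonal to the image of [Psi], is not
tangent. *)
Let p (k : 'I_#|I|) : subvs_of T := vsproj T (e (enum_val k)).
Let q (k : 'I_#|I|) : subvs_of T := vsproj T (- f (enum_val k)).

Lemma lam_enum (k : 'I_#|I|) : lam (enum_val k) != 0.
Proof. by have := enum_valP k; rewrite inE. Qed.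

Lemma e_tangent i : lam i != 0 -> e i \in T.
Proof.
move=> l0; rewrite /e -[tnth b i](scalerK l0) -Psi_Phi linearZ memvZ //.
exact: Psi_tangent.
Qed.

Lemma vsval_p k : vsval (p k) = e (enum_val k).
Proof. by rewrite vsprojK // e_tangent ?lam_enum. Qed.
Lemma vsval_q k : vsval (q k) = - f (enum_val k).
Proof. by rewrite vsprojK // Phi_tangent. Qed.

(** The whole family, [e]s and [f]s together, is orthogonal with nonzero squares
[<e i, e i>] and [lam i <e i, e i>]; pairing a relation with each of its members
kills the coefficients one by one. *)
Lemma pq_free (c d : 'I_#|I| -> R) :
  \sum_i c i *: p i + \sum_i d i *: q i = 0 ->
  (forall i, c i = 0) /\ (forall i, d i = 0).
Proof.
move=> /(congr1 vsval); rewrite linearD !linear_sum /= => E.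
have cd0 z : \sum_k c k * ip (e (enum_val k)) z +
    \sum_k d k * ip (- f (enum_val k)) z = 0.
  have /= := congr1 (ip^~ z) E; rewrite sym0l symDl !sym_suml => E0.
  rewrite -[RHS]E0.
  congr (_ + _); apply: eq_bigr => k _.
    by rewrite -vsval_p -symZl.
  by rewrite -vsval_q -symZl.
split=> k.
  have := cd0 (e (enum_val k)); rewrite [X in _ + X]big1 => [|j _]; last first.
    by rewrite symNl ip_fe oppr0 mulr0.
  rewrite addr0 (bigD1 k) //= big1 ?addr0 => [|j jk]; last first.
    by rewrite ip_ee ?mulr0 // (inj_eq enum_val_inj).
  by move/eqP; rewrite mulf_eq0 (negPf (ip_ee_neq0 _)) orbF => /eqP.
have := cd0 (f (enum_val k)); rewrite [X in X + _]big1 => [|j _]; last first.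
  by rewrite symC ip_fe mulr0.
rewrite add0r (bigD1 k) //= big1 ?addr0 => [|j jk]; last first.
  rewrite symNl ip_ff ip_ee ?mulr0 ?oppr0 ?mulr0 //.
  by rewrite (inj_eq enum_val_inj) eq_sym.
move/eqP; rewrite symNl ip_ff mulf_eq0 oppr_eq0 mulf_eq0.
by rewrite (negPf (ip_ee_neq0 _)) (negPf (lam_enum _)) /= orbF => /eqP.
Qed.

(** The indices with [lam i = 0] contribute nothing: there [Phi] kills the basis
vector, and by adjointness the image of [Psi] is orthogonal to it. *)
Lemma pq_span (xi : subvs_of T) : exists c d : 'I_#|I| -> R,
  xi = \sum_i c i *: p i + \sum_i d i *: q i.
Proof.
have [x1 [x2 xiE]] := tangent_Psi_Phi (subvsP xi).
pose c i := coord b i (Psi x1); pose d i := coord b i x2.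
have bE x : x = \sum_i coord b i x *: tnth b i.
  rewrite [LHS](coord_basis (aeb_basis Hb) (memvf x)); apply: eq_bigr => i _.
  by rewrite (tnth_nth 0).
(* [Psi x1] is orthogonal to the kernel of [Phi]. *)
have c0 i : lam i = 0 -> c i = 0.
  move=> l0; have : ip (vsval (Psi x1)) (e i) = 0.
    by rewrite -(hr_j_adj H) lam0_Phi // linear0 sym0l.
  rewrite [Psi x1]bE linear_sum sym_suml (bigD1 i) //= big1 ?addr0 => [|j ji].
    by rewrite symZl => /eqP; rewrite mulf_eq0 (negPf (ip_ee_neq0 _)) orbF => /eqP.
  by rewrite ?linearZ /= symZl ip_ee ?mulr0.
have sumI (F : 'I_(\dim (hr_v2 B ip)) -> g) :
    (forall i, lam i = 0 -> F i = 0) ->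
    \sum_i F i = \sum_(k < #|I|) F (enum_val k).
  move=> F0; rewrite -(big_enum_val F) [RHS]big_mkcond; apply: eq_bigr => i _.
  by rewrite inE; case: eqVneq => [/F0|].
have PsiE : vsval (Psi x1) = \sum_i c i *: e i.
  by rewrite {1}[Psi x1]bE linear_sum.
have PhiE : - vsval (Phi x2) = \sum_i d i *: (- f i).
  rewrite {1}[x2]bE !linear_sum; apply: eq_bigr => i _.
  by rewrite /= linearZ /= scalerN.
exists (c \o enum_val), (d \o enum_val); apply: val_inj.
rewrite /= xiE PsiE PhiE !sumI => [|i /lam0_Phi fi0|i /c0 ->]; last 2 first.
- by rewrite /f fi0 linear0 ?oppr0 ?scaler0 ?oppr0.
- by rewrite scale0r.
rewrite !linear_sum; congr (_ + _); apply: eq_bigr => k _;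
by rewrite /= ?vsval_p ?vsval_q.
Qed.

Lemma hr_char_poly :
  char_poly_lfun hr_linearization =
    \prod_(k < #|I|) ('X^2 - (- lam (enum_val k))%:P).
Proof.
apply: (char_poly_paired (p := p) (q := q)); last 2 first.
- exact: pq_free.
- exact: pq_span.
- move=> k; apply: val_inj; rewrite /= hr_linearizationE vsval_p vsval_q.
  exact: (coad_v2 H YW).
move=> k; apply: val_inj; rewrite /= hr_linearizationE vsval_q vsval_p /f -linearN.
by rewrite (coad_v1 H YW) !linearN /= Psi_Phi linearZ /= scaleNr scalerN.
Qed.

Lemma hr_spectrum : williamson_spectrum hr_linearization
  (hr_d1 b lam + hr_d4 b lam) (hr_d2 b lam + hr_d3 b lam) 0.
Proof.
(* Since squares are [1] or [-1], counting by sign of the square loses no index. *)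
have S (P : pred R) : ~~ P 0 -> (\sum_(k < #|I|) P (lam (enum_val k)) =
  #|[set i | (restr ip _ (tnth b i) (tnth b i) == 1%R) && P (lam i)]| +
  #|[set i | (restr ip _ (tnth b i) (tnth b i) == (-1)%R) && P (lam i)]|)%N.
  move=> P0; rewrite -(big_enum_val (fun i => P (lam i) : nat)) /=.
  have cE (Q : pred 'I_(\dim (hr_v2 B ip))) : #|[set i | Q i]| = (\sum_i Q i)%N.
    rewrite -sum1_card big_mkcond; apply: eq_bigr => i _.
    by rewrite inE; case: (Q i).
  rewrite !cE big_mkcond -big_split /=; apply: eq_bigr => i _; rewrite !inE.
  have [->|l0] := eqVneq (lam i) 0; first by rewrite (negPf P0) !andbF.
  have one : (1 == -1 :> R) = false by rewrite -subr_eq0 opprK -mulr2n pnatr_eq0.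
  by case: (aeb_norm Hb i) => ->; rewrite ?[-1 == _]eq_sym one eqxx /=; case: (P _).
have := williamson_paired _ hr_char_poly.
have -> : (\sum_(i < #|I|) (- lam (enum_val i) < 0)%R)%N =
    (hr_d1 b lam + hr_d4 b lam)%N.
  by rewrite -S ?ltxx //; apply: eq_bigr => k _; rewrite oppr_lt0.
have -> : (\sum_(i < #|I|) (0 < - lam (enum_val i))%R)%N =
    (hr_d2 b lam + hr_d3 b lam)%N.
  rewrite -(S (fun x => x < 0)) ?ltxx //.
  by apply: eq_bigr => k _; rewrite oppr_gt0.
by apply=> k; rewrite oppr_eq0 lam_enum.
Qed.

End Spectrum.

(** * The Williamson type *)

Lemma adapted_eigenbasis_exists (R : realType) (u1 u2 w : vectType R)
    (B : {bilinear u1 -> u2 -> w}) (ip : {symmetric (u1 * u2 * w)%type}) (W : w) :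
  hr_scalar_product B ip ->
  diagonalizable_lfun (hr_j21 B ip W \o hr_j12 B ip W)%VF ->
  exists b lam, @adapted_eigenbasis R u1 u2 w B ip W b lam.
Proof.
move=> H Td.
have sa x y : restr ip (hr_v2 B ip) ((hr_j21 B ip W \o hr_j12 B ip W)%VF x) y =
    restr ip (hr_v2 B ip) x ((hr_j21 B ip W \o hr_j12 B ip W)%VF y).
  rewrite /restr !comp_lfunE -(hr_j_adj H) [RHS]symC -(hr_j_adj H).
  exact: symC.
have [s [sb es os ns]] := orthonormal_eigenbasis sa (hr_ip_v2 H) Td.
have sz : size s == \dim (hr_v2 B ip).
  have := size_basis (X := in_tuple s) sb; rewrite dimvf => <-.
  by rewrite /dim /=.
pose b := Tuple sz.
have bs i : tnth b i \in s by exact: mem_tnth.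
have ex i :
    exists c, (hr_j21 B ip W \o hr_j12 B ip W)%VF (tnth b i) = c *: tnth b i.
  exact: es.
exists b, (fun i => sval (cid (ex i))); split.
- exact: sb.
- by move=> i; exact: svalP (cid (ex i)).
- move=> i j ij; apply: os => //.
  have us : uniq b := free_uniq (basis_free sb).
  by apply: contra ij => /eqP/(tuple_uniqP b us)/eqP.
- by move=> i; exact: ns.
Qed.

Lemma ip_covector_w (R : realType) (u1 u2 w : vectType R) (B : {bilinear u1 -> u2 -> w})
    (ip : {symmetric (u1 * u2 * w)%type}) (Yv Yz_bar : (u1 * u2 * w)%type) (W : w) :
  hr_scalar_product B ip -> Yv \in hr_v B ip -> Yz_bar \in (hr_u1o B + hr_u2o B)%VS ->
  forall c, ip (Yv + (Yz_bar + in_w u1 u2 W)) (in_w u1 u2 c) =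
    ip (in_w u1 u2 W) (in_w u1 u2 c).
Proof.
move=> H Yvv /memv_addP[_ /memv_imgP[x _ ->] [_ /memv_imgP[y _ ->] ->]] c.
rewrite !lfunE !symDl (ip_vz Yvv (in_w_z _ _)) add0r.
by rewrite (ip_u1w H) (ip_u2w H) !add0r.
Qed.

Theorem theorem3p9 (R : realType) (u1 u2 w : vectType R)
    (B : {bilinear u1 -> u2 -> w}) (ip : {symmetric (u1 * u2 * w)%type})
    (G : lie_group (hr_bracket B))
    (Y Yv Yz Yz_bar : (u1 * u2 * w)%type) (Yz_0 : w) :
  hr_scalar_product B ip ->
  Y = Yv + Yz -> Yv \in hr_v B ip -> Yz \in hr_z B ->
  hr_j B ip Yz (vsproj (hr_v B ip) Yv) = 0 ->
  Yz = Yz_bar + in_w u1 u2 Yz_0 -> Yz_bar \in (hr_u1o B + hr_u2o B)%VS ->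
  diagonalizable_lfun (hr_j21 B ip Yz_0 \o hr_j12 B ip Yz_0)%VF ->
  nondegenerate (restr (restr ip (hr_v1 B ip)) (limg (hr_j12 B ip Yz_0))) ->
  (exists b lam, @adapted_eigenbasis R u1 u2 w B ip Yz_0 b lam) /\
  (forall b lam, @adapted_eigenbasis R u1 u2 w B ip Yz_0 b lam ->
     orbit_williamson_type ip G (hr_hamiltonian ip) (lie_poisson B ip) Y
       (hr_d1 b lam + hr_d4 b lam) (hr_d2 b lam + hr_d3 b lam) 0).
Proof.
move=> H YE Yvv Yzz jY YzE Ybar Td Phi_nd.
have YW c : ip Y (in_w u1 u2 c) = ip (in_w u1 u2 Yz_0) (in_w u1 u2 c).
  by rewrite YE YzE (ip_covector_w _ H).
split; first exact: adapted_eigenbasis_exists.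
move=> b lam Hb; split.
- apply: euler_hamiltonian (lie_poisson_coad H); first exact: hr_bracket_alt.
  exact: hr_ip_nondeg H.
- have piv : daddv_pi (hr_v B ip) (hr_z B) Y = Yv.
    rewrite YE linearD /= daddv_pi_id ?capv_z //.
    have := hr_pi_add H Yz; rewrite [X in _ + X]daddv_pi_id //; last first.
      by rewrite capvC capv_z.
    by move/(canRL (addrK _)); rewrite subrr => ->; rewrite addr0.
  have piz : daddv_pi (hr_z B) (hr_v B ip) Y = Yz.
    by apply: (addrI Yv); rewrite -{1}piv hr_pi_add.
  by rewrite /lie_poisson piv piz jY linear0.
exists (hr_linearization B ip Y); last exact: hr_spectrum.
apply: (euler_linearization (hr_ip_nondeg H)); first exact: lie_poisson_coad.
move=> xi; rewrite [X in _ + X](coad_tangent H (subvsP xi)) addr0.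
exact: hr_linearizationE.
Qed.
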